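(* Let $G$ be the group $McL\!:\!2$ in its primitive permutation action on $275$ points. Then $G$ does not contain a sharply transitive set of permutations.
   Context: A set $S$ of permutations of a finite set $\Omega$ is called sharply transitive on $\Omega$ if for all $x,y\in\Omega$ there is a unique $s\in S$ with $x^s=y$ (where $x^s$ is the image of $x$ under $s$); $S$ need not be a subgroup. $McL$ is the sporadic simple McLaughlin group and $McL\!:\!2$ is its automorphism group. As a permutation group on $275$ points, $McL\!:\!2$ is the full automorphism group of the McLaughlin graph $\Gamma$ acting on its $275$ vertices. $\Gamma$ is a strongly regular graph with parameters $(275,112,30,56)$ and can be constructed as follows. Let $\mathcal W_{23}$ be the Witt design, i.e. the (unique up to isomorphism) Steiner system with $23$ points and blocks of size $7$ such that any $4$ distinct points lie in exactly one block. Fix a point $q$, let $B$ be the set of the other $22$ points, $U$ the set of the $77$ blocks containing $q$, and $V$ the set of the $176$ blocks not containing $q$. The vertex set of $\Gamma$ is $B\cup U\cup V$. The elements of $B$ are pairwise non-adjacent, and for $b\in B$, distinct $u,u'\in U$, and distinct $v,v'\in V$: $b\sim u$ iff $b\notin u$; $b\sim v$ iff $b\in v$; $u\sim u'$ iff $|u\cap u'|=1$; $v\sim v'$ iff $|v\cap v'|=1$; $u\sim v$ iff $|u\cap v|=3$. *)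

(* Defs.v *)
From mathcomp Require Import all_boot all_fingroup.

Set Implicit Arguments.
Unset Strict Implicit.
Unset Printing Implicit Defensive.

Definition sharply_transitive (Omega : finType) (S : {set {perm Omega}}) :
    Prop :=
  forall x y : Omega, exists! s : {perm Omega}, s \in S /\ s x = y.

(* W is the block set of a Steiner system S(t, k, v) on the point set T. *)
Definition steiner_system (t k v : nat) (T : finType) (W : {set {set T}}) :
    Prop :=
  [/\ #|T| = v,
      forall b : {set T}, b \in W -> #|b| = k
    & forall A : {set T}, #|A| = t ->
        exists! b : {set T}, b \in W /\ A \subset b].

Definition graph_aut (X : finType) (e : rel X) : {set {perm X}} :=
  [set s : {perm X} | [forall x, forall y, e (s x) (s y) == e x y]].

Lemma graph_aut_group_set (X : finType) (e : rel X) : group_set (graph_aut e).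
Proof.
apply/group_setP; split=> [|s t].
  by rewrite inE; apply/forallP=> x; apply/forallP=> y; rewrite !perm1.
rewrite !inE => /forallP hs /forallP ht; apply/forallP=> x; apply/forallP=> y.
by rewrite !permM (eqP (forallP (ht _) _)) (eqP (forallP (hs _) _)).
Qed.

Canonical graph_aut_group (X : finType) (e : rel X) : {group {perm X}} :=
  Group (graph_aut_group_set e).

Section McLaughlinGraph.

(* W is meant to be the Witt design S(4, 7, 23) and q a fixed point of it;    *)
(* the vertices are the disjoint union of the other points, the blocks        *)
(* through q and the blocks avoiding q.                                       *)
Variables (T : finType) (W : {set {set T}}) (q : T).

Definition mclB := {b : T | b != q}.
Definition mclU := {u : {set T} | (u \in W) && (q \in u)}.
Definition mclV := {v : {set T} | (v \in W) && (q \notin v)}.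

Definition mcl_vertex : finType := (mclB + (mclU + mclV))%type.

Definition mcl_adj : rel mcl_vertex := fun x y =>
  match x, y with
  | inl _, inl _ => false
  | inl b, inr (inl u) | inr (inl u), inl b => val b \notin val u
  | inl b, inr (inr v) | inr (inr v), inl b => val b \in val v
  | inr (inl u), inr (inl u') => (u != u') && (#|val u :&: val u'| == 1)
  | inr (inr v), inr (inr v') => (v != v') && (#|val v :&: val v'| == 1)
  | inr (inl u), inr (inr v) | inr (inr v), inr (inl u) =>
      #|val u :&: val v| == 3
  end.

Lemma mcl_adj_sym : symmetric mcl_adj.
Proof. by case=> [b|[u|v]] [b'|[u'|v']] //=; rewrite eq_sym setIC. Qed.

Lemma mcl_adj_irrefl : irreflexive mcl_adj.
Proof. by case=> [b|[u|v]] //=; rewrite eqxx. Qed.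

(* When W is S(4, 7, 23), the full automorphism group of the McLaughlin graph *)
(* is McL:2 in its primitive action of degree 275.                            *)
Definition McL2 : {group {perm mcl_vertex}} := graph_aut_group mcl_adj.

End McLaughlinGraph.

(* Main.v *)
Require Import Defs.
From mathcomp Require Import all_boot all_fingroup.
From mathcomp Require Import zify.

(** The proof is a double count modulo 3. If S is sharply transitive, then for
    any sets A and C of vertices the numbers of x in A that s maps into C add
    up to #|A| * #|C| as s runs over S
    ([sum_card_sharply_transitive]). So a prime that divides each of these
    numbers for every s in the group, but not #|A| * #|C|, rules S out.

    Take for A the 22 vertices that are points, and for C the common
    neighbours of two of these points a and b. An automorphism s maps a vertex
    z into C exactly when z is a common neighbour of s^-1 a and s^-1 b, which
    are again distinct and non-adjacent. Hence it is enough to know that any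
    two distinct non-adjacent vertices have a number of common neighbours in A
    that is divisible by 3 ([dvdn3_common_nbrs_in_points]), whereas
    #|A| * #|C| = 22 * 56 is not.

    The divisibility can be read off from the intersections of blocks. Two
    distinct blocks of the Witt design share 1 or 3 points
    ([witt_block_meet]), so non-adjacency of two vertices fixes the
    intersection size of the corresponding blocks. The number of common
    neighbours in A is then
    - 0 if one of the two vertices is itself a point;
    - 23 - (7 + 7 - 3) = 12 for two blocks through q, namely the points
      outside both;
    - 7 - 1 = 6 for a block through q and a block avoiding q, namely the
      points of the second outside the first;
    - 3 for two blocks avoiding q, namely the points of both.

    The size 56 of C is an inclusion-exclusion between the numbers 77, 21 and 5
    of blocks through 1, 2 and 3 given points. *)

Set Implicit Arguments.
Unset Strict Implicit.
Unset Printing Implicit Defensive.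

(** * Counting blocks of a Steiner system *)

(** X |-> X :\: A identifies these sets with the subsets of C :\: A of size
    m - #|A|. *)
Lemma card_subsets_between (T : finType) (A C : {set T}) (m : nat) :
    A \subset C -> #|A| <= m ->
  #|[set X : {set T} | [&& A \subset X, X \subset C & #|X| == m]]|
    = 'C(#|C| - #|A|, m - #|A|).
Proof.
move=> sAC leAm; rewrite -(cardsDS sAC) -cards_draws.
have disjA (Y : {set T}) : Y \subset C :\: A -> A :&: Y = set0.
  by rewrite subsetD disjoint_sym => /andP[_ /disjoint_setI0].
rewrite -[RHS](card_in_imset (f := fun Y => A :|: Y)); last first.
  move=> Y Z; rewrite !inE => /andP[/disjA dY _] /andP[/disjA dZ _] eqYZ.
  have DK (X : {set T}) : A :&: X = set0 -> (A :|: X) :\: A = X.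
    by move=> dX; rewrite setDUl setDv set0U; apply/setDidPl;
       rewrite -setI_eq0 setIC dX.
  by rewrite -(DK Y) // eqYZ DK.
apply/eq_card => X; rewrite inE; apply/idP/imsetP.
  case/and3P=> sAX sXC /eqP cX; exists (X :\: A).
    by rewrite !inE setSD //= cardsDS // cX.
  by rewrite setDE setUIr setUCr setIT (setUidPr sAX).
case=> Y; rewrite !inE => /andP[sYD /eqP cY] ->.
rewrite subsetUl subUset sAC (subset_trans sYD (subsetDl _ _)) /=.
by rewrite cardsU (disjA _ sYD) cards0 subn0 cY subnKC.
Qed.

(** Both sides count the t-sets X containing A: each lies in one block, which
    then contains A, and each block through A contains the same number of such
    X. *)
Lemma card_blocks_through (t k v : nat) (T : finType) (W : {set {set T}})
    (A : {set T}) :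
    steiner_system t k v W -> #|A| <= t ->
  #|[set b in W | A \subset b]| * 'C(k - #|A|, t - #|A|)
    = 'C(v - #|A|, t - #|A|).
Proof.
case=> cT cW uW leAt.
have -> : 'C(v - #|A|, t - #|A|)
    = \sum_(X : {set T} | (A \subset X) && (#|X| == t)) 1.
  rewrite sum1dep_card -cT -cardsT -card_subsets_between ?subsetT //.
  by apply: eq_card => X; rewrite !inE subsetT.
transitivity (\sum_(X : {set T} | (A \subset X) && (#|X| == t))
                 \sum_(b in W | X \subset b) 1).
  rewrite (exchange_big_dep (fun b => (b \in W) && (A \subset b))) /=; last first.
    by move=> X b /andP[sAX _] /andP[-> sXb]; rewrite (subset_trans sAX).
  rewrite -sum_nat_const; apply: eq_big => [b|b]; first by rewrite inE.
  rewrite inE => /andP[Wb sAb]; rewrite sum1dep_card -(cW b Wb) -card_subsets_between //.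
  by apply: eq_card => X; rewrite !inE Wb -andbA (andbC (X \subset b)).
apply: eq_bigr => X /andP[_ /eqP cX].
have [b [[Wb sXb] ub]] := uW X cX.
rewrite sum1dep_card; apply/eqP/cards1P; exists b; apply/setP=> c.
rewrite !inE; apply/idP/eqP => [/andP[Wc sXc]|->]; last by rewrite Wb.
by rewrite (ub c).
Qed.

(** Each term of the sum counts the j-subsets of b inside c; exchanging the
    summation, each of the 'C(k, j) subsets of b of size j lies in the number
    of blocks given by [card_blocks_through]. For j = 0, 1, ..., t these are
    the equations that control how the blocks of the system meet b. *)
Lemma sum_bin_block_meets (t k v : nat) (T : finType) (W : {set {set T}})
    (b : {set T}) (j : nat) :
    steiner_system t k v W -> b \in W -> j <= t ->
  (\sum_(c in W) 'C(#|b :&: c|, j)) * 'C(k - j, t - j)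
    = 'C(k, j) * 'C(v - j, t - j).
Proof.
move=> hW Wb lejt; have [_ cW _] := hW.
have -> : \sum_(c in W) 'C(#|b :&: c|, j)
    = \sum_(X : {set T} | (X \subset b) && (#|X| == j)) \sum_(c in W | X \subset c) 1.
  rewrite (exchange_big_dep (mem W)) /=; last by move=> X c _ /andP[].
  apply: eq_bigr => c Wc; rewrite sum1dep_card -cards_draws.
  by apply: eq_card => X; rewrite !inE subsetI Wc andbAC.
rewrite big_distrl /= -[X in 'C(X, j)](cW b Wb) -cards_draws -sum_nat_const.
apply: eq_big => [X|X /andP[_ /eqP cX]]; first by rewrite !inE.
by rewrite sum1dep_card -cX (card_blocks_through hW) // cX.
Qed.

Lemma witt_blocks_through (T : finType) (W : {set {set T}}) (A : {set T}) :
    steiner_system 4 7 23 W -> #|A| <= 3 ->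
  #|[set b in W | A \subset b]| = nth 0 [:: 253; 77; 21; 5] #|A|.
Proof.
move=> hW leA3; have := card_blocks_through hW (leqW leA3).
case: #|A| leA3 => [|[|[|[|//]]]] _ eqC; apply/eqP.
- by rewrite -(@eqn_pmul2r 'C(7 - 0, 4 - 0)) // eqC; vm_compute.
- by rewrite -(@eqn_pmul2r 'C(7 - 1, 4 - 1)) // eqC; vm_compute.
- by rewrite -(@eqn_pmul2r 'C(7 - 2, 4 - 2)) // eqC; vm_compute.
- by rewrite -(@eqn_pmul2r 'C(7 - 3, 4 - 3)) // eqC; vm_compute.
Qed.

(** * Intersections of blocks of the Witt design *)

(** Two distinct blocks share at most 3 points, since 4 points lie in one
    block only. The binomial sums over all blocks c other than b, i being the
    size of b :&: c, are known for j <= 3, and suitable combinations of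
    binomials vanish at all but one value of i <= 3: 'C(i, 2) - 3 * 'C(i, 3) is
    the indicator of i = 2, and 1 - i + 'C(i, 2) - 'C(i, 3) that of i = 0. Both
    combinations sum to 0, so neither value occurs. *)
Lemma witt_block_meet (T : finType) (W : {set {set T}}) (b c : {set T}) :
    steiner_system 4 7 23 W -> b \in W -> c \in W -> c != b ->
  #|b :&: c| = 1 \/ #|b :&: c| = 3.
Proof.
move=> hW Wb Wc neq_cb; have [_ cW uW] := hW.
have le3 d : d \in W -> d != b -> #|b :&: d| <= 3.
  move=> Wd; apply: contraNT; rewrite -ltnNge => gt3.
  have [X] : exists X, X \in [set X : {set T} | X \subset b :&: d & #|X| == 4].
    by apply/card_gt0P; rewrite cards_draws bin_gt0.
  rewrite inE subsetI => /andP[/andP[sXb sXd] /eqP cX].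
  by have [e [_ ue]] := uW X cX; rewrite -(ue b) // -(ue d).
(* The term 'C(7, j) is the contribution of the block b itself. *)
have E (j s : nat) : j <= 4 ->
    'C(7, j) * 'C(23 - j, 4 - j) == ('C(7, j) + s) * 'C(7 - j, 4 - j) ->
  \sum_(d in W | d != b) 'C(#|b :&: d|, j) = s.
  move=> lej /eqP Es; apply/eqP; rewrite -(eqn_add2l 'C(7, j)).
  rewrite -(@eqn_pmul2r 'C(7 - j, 4 - j)); last by rewrite bin_gt0; lia.
  rewrite -Es -(sum_bin_block_meets hW Wb lej) [X in _ == X * _](bigD1 b) //=.
  by rewrite setIid cW.
have E0 : \sum_(d in W | d != b) 'C(#|b :&: d|, 0) = 252.
  by apply: E; last by vm_compute.
have E1 : \sum_(d in W | d != b) 'C(#|b :&: d|, 1) = 532.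
  by apply: E; last by vm_compute.
have E2 : \sum_(d in W | d != b) 'C(#|b :&: d|, 2) = 420.
  by apply: E; last by vm_compute.
have E3 : \sum_(d in W | d != b) 'C(#|b :&: d|, 3) = 140.
  by apply: E; last by vm_compute.
have n2 : \sum_(d in W | d != b) (#|b :&: d| == 2) = 0.
  suff : \sum_(d in W | d != b) (3 * 'C(#|b :&: d|, 3) + (#|b :&: d| == 2)) = 420.
    by rewrite big_split -big_distrr /= E3; lia.
  rewrite -E2; apply: eq_bigr => d /andP[Wd neq_db].
  by case: #|_| (le3 d Wd neq_db) => [|[|[|[|]]]].
have n0 : \sum_(d in W | d != b) (#|b :&: d| == 0) = 0.
  suff : \sum_(d in W | d != b)
            ('C(#|b :&: d|, 1) + 'C(#|b :&: d|, 3) + (#|b :&: d| == 0))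
         = \sum_(d in W | d != b) ('C(#|b :&: d|, 0) + 'C(#|b :&: d|, 2)).
    by rewrite !big_split /= E0 E1 E2 E3; lia.
  apply: eq_bigr => d /andP[Wd neq_db].
  by case: #|_| (le3 d Wd neq_db) => [|[|[|[|]]]].
have neq m : \sum_(d in W | d != b) (#|b :&: d| == m) = 0 -> #|b :&: c| <> m.
  by rewrite (bigD1 c) /= ?Wc //; case: eqP.
by move: (neq 0 n0) (neq 2 n2) (le3 c Wc neq_cb); lia.
Qed.

(** * Double counting with a sharply transitive set *)

(** For each of the #|A| * #|C| pairs (x, y) exactly one s in S maps x to y. *)
Lemma sum_card_sharply_transitive (X : finType) (S : {set {perm X}})
    (A C : {set X}) :
    sharply_transitive S ->
  \sum_(s in S) #|[set x in A | s x \in C]| = #|A| * #|C|.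
Proof.
move=> trS.
have -> : \sum_(s in S) #|[set x in A | s x \in C]|
    = \sum_(s in S) \sum_(x in A) \sum_(y in C | s x == y) 1.
  apply: eq_bigr => s _; rewrite -sum1dep_card big_mkcondr /=.
  apply: eq_bigr => x _; case: ifP => Csx.
    by rewrite (big_pred1 (s x)) // => y /=; rewrite eq_sym andbC; case: eqP => // ->.
  by rewrite big1 // => y /andP[Cy /eqP E]; rewrite E Cy in Csx.
rewrite exchange_big /= -sum_nat_const; apply: eq_bigr => x _.
rewrite (exchange_big_dep (mem C)) /=; last by move=> s y _ /andP[].
rewrite -sum1_card; apply: eq_bigr => y Cy.
have [s [[Ss sxy] us]] := trS x y.
rewrite (big_pred1 s) // => r /=; rewrite Cy /=.
apply/andP/eqP => [[Sr /eqP rxy]|->]; last by rewrite sxy.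
by rewrite (us r).
Qed.

Lemma dvdn_card_sharply_transitive (X : finType) (S : {set {perm X}})
    (A C : {set X}) (d : nat) :
    sharply_transitive S ->
    (forall s, s \in S -> d %| #|[set x in A | s x \in C]|) ->
  d %| #|A| * #|C|.
Proof. by move=> trS dvS; rewrite -(sum_card_sharply_transitive A C trS) dvdn_sum. Qed.

Lemma graph_autE (X : finType) (e : rel X) (s : {perm X}) (x y : X) :
  s \in graph_aut e -> e (s x) (s y) = e x y.
Proof. by rewrite inE => /forallP/(_ x)/forallP/(_ y)/eqP. Qed.

(** * The McLaughlin graph *)

Lemma card_sig_set (I : finType) (Q P : pred I) :
  #|[set y : {x : I | Q x} | P (val y)]| = #|[set x | Q x && P x]|.
Proof.
rewrite -(card_imset _ val_inj); apply: eq_card => x; rewrite inE.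
apply/imsetP/andP => [[y]|[Qx Px]].
  by rewrite inE => Py ->; split=> //; apply: (valP y).
by exists (exist (fun x => Q x) x Qx); rewrite ?inE.
Qed.

Definition mcl_points (T : finType) (W : {set {set T}}) (q : T) :
    {set mcl_vertex W q} :=
  [set inl b | b : mclB q].

(** Turns a count of point vertices into a count of elements of T, where the
    cardinality lemmas for sets of points and blocks apply. *)
Lemma card_mcl_points_if (T : finType) (W : {set {set T}}) (q : T)
    (Q : pred (mcl_vertex W q)) (P : pred T) :
    (forall b : mclB q, Q (inl b) = P (val b)) ->
  #|[set x in mcl_points W q | Q x]| = #|[set t | (t != q) && P t]|.
Proof.
move=> eqQP; rewrite -[RHS]card_sig_set.
rewrite -[RHS](card_imset _ (@inl_inj (mclB q) (mclU W q + mclV W q))).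
apply: eq_card => x; rewrite inE; apply/andP/imsetP.
  by case=> /imsetP[b _ ->] Qb; exists b; rewrite ?inE -?eqQP.
by case=> b; rewrite inE -eqQP => Qb ->; rewrite imset_f.
Qed.

Lemma card_mcl_points (T : finType) (W : {set {set T}}) (q : T) :
  #|T| = 23 -> #|mcl_points W q| = 22.
Proof.
move=> cT; rewrite card_imset; last exact: inl_inj.
by rewrite card_sig cardC1 cT.
Qed.

(** Each case is one set operation on two blocks whose intersection size is
    forced by [witt_block_meet] and non-adjacency. The condition t != q on the
    points of the graph is absorbed by that operation, because q lies in the
    blocks of the second kind and outside those of the third. *)
Lemma dvdn3_common_nbrs_in_points (T : finType) (W : {set {set T}}) (q : T)
    (x y : mcl_vertex W q) :
    steiner_system 4 7 23 W -> x != y -> ~~ mcl_adj x y ->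
  3 %| #|[set z in mcl_points W q | mcl_adj x z && mcl_adj y z]|.
Proof.
move=> hW; have [cT cW _] := hW.
have none (a : mclB q) (w : mcl_vertex W q) :
    [set z in mcl_points W q | mcl_adj (inl a : mcl_vertex W q) z && mcl_adj w z] = set0.
  by apply/setP=> z; rewrite !inE; apply/andP=> -[/imsetP[c _ ->]].
have uu (u u' : mclU W q) : u != u' -> #|val u :&: val u'| != 1 ->
    3 %| #|[set t | (t != q) && ((t \notin val u) && (t \notin val u'))]|.
  rewrite -val_eqE eq_sym => neq n1.
  have /andP[Wu qu] := valP u; have /andP[Wu' qu'] := valP u'.
  have [m1|m3] := witt_block_meet hW Wu Wu' neq; first by rewrite m1 in n1.
  rewrite (_ : [set _ | _] = ~: (val u :|: val u')); last first.
    by apply/setP=> t; rewrite !inE negb_or; case: eqP => // ->; rewrite qu.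
  by rewrite cardsCs setCK cT cardsU m3 !cW.
have uv (u : mclU W q) (v : mclV W q) : #|val u :&: val v| != 3 ->
    3 %| #|[set t | (t != q) && ((t \notin val u) && (t \in val v))]|.
  move=> n3; have /andP[Wu qu] := valP u; have /andP[Wv qv] := valP v.
  have neq : val v != val u by apply: contraNneq qv => ->.
  have [m1|m3] := witt_block_meet hW Wu Wv neq; last by rewrite m3 in n3.
  rewrite (_ : [set _ | _] = val v :\: val u); last first.
    by apply/setP=> t; rewrite !inE; case: eqP => // ->; rewrite qu.
  by rewrite cardsD setIC m1 cW.
have vv (v v' : mclV W q) : v != v' -> #|val v :&: val v'| != 1 ->
    3 %| #|[set t | (t != q) && ((t \in val v) && (t \in val v'))]|.
  rewrite -val_eqE eq_sym => neq n1.
  have /andP[Wv qv] := valP v; have /andP[Wv' qv'] := valP v'.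
  have [m1|m3] := witt_block_meet hW Wv Wv' neq; first by rewrite m1 in n1.
  rewrite (_ : [set _ | _] = val v :&: val v') ?m3 //.
  by apply/setP=> t; rewrite !inE; case: eqP => // ->; rewrite (negPf qv).
have noner (a : mclB q) (w : mcl_vertex W q) :
    [set z in mcl_points W q | mcl_adj w z && mcl_adj (inl a : mcl_vertex W q) z] = set0.
  by rewrite -[RHS](none a w); apply/setP=> z; rewrite !inE (andbC (mcl_adj w z)).
case: x y => [a|[u|v]] [a'|[u'|v']] neq nadj; rewrite ?none ?noner ?cards0 //.
- rewrite (card_mcl_points_if (P := fun t => (t \notin val u) && (t \notin val u'))) //.
  have neq_u : u != u' by apply: contra neq => /eqP->.
  by apply: uu => //; move: nadj; rewrite /= neq_u.
- rewrite (card_mcl_points_if (P := fun t => (t \notin val u) && (t \in val v'))) //.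
  exact: uv.
- rewrite (card_mcl_points_if (P := fun t => (t \notin val u') && (t \in val v))).
    by apply: uv; move: nadj => /=.
  by move=> b /=; rewrite andbC.
- rewrite (card_mcl_points_if (P := fun t => (t \in val v) && (t \in val v'))) //.
  have neq_v : v != v' by apply: contra neq => /eqP->.
  by apply: vv => //; move: nadj; rewrite /= neq_v.
Qed.

Lemma card_vertex_set (T : finType) (W : {set {set T}}) (q : T)
    (Q : pred (mcl_vertex W q)) :
  #|[set z | Q z]| = #|[set b | Q (inl b)]|
    + (#|[set u | Q (inr (inl u))]| + #|[set v | Q (inr (inr v))]|).
Proof. by rewrite -!sum1dep_card !big_sumType. Qed.

(** The common neighbours are the blocks through q that avoid a and b, numbering
    77 - 2 * 21 + 5 = 40, and the blocks through a and b that avoid q,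
    numbering 21 - 5 = 16. *)
Lemma card_common_nbrs_points (T : finType) (W : {set {set T}}) (q : T)
    (a b : mclB q) :
    steiner_system 4 7 23 W -> a != b ->
  #|[set z : mcl_vertex W q |
       mcl_adj (inl a : mcl_vertex W q) z && mcl_adj (inl b : mcl_vertex W q) z]|
    = 56.
Proof.
move=> hW; case: a b => [a /= neq_aq] [b /= neq_bq]; rewrite -val_eqE /= => neq_ab.
pose n (P : pred {set T}) := #|[set c in W | P c]|.
have eqn P P' : P =1 P' -> n P = n P'.
  by move=> eqP; apply: eq_card => c; rewrite !inE eqP.
have split (t : T) (P : pred {set T}) :
    n P = n (fun c => P c && (t \in c)) + n (fun c => P c && (t \notin c)).
  rewrite /n -(cardsID [set c : {set T} | t \in c]).
  congr (_ + _); apply: eq_card => c; rewrite !inE andbA //.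
  by rewrite -andbA andbC -andbA.
have n_q : n (fun c => q \in c) = 77.
  rewrite (eqn _ (fun c => [set q] \subset c)) => [|c]; last by rewrite sub1set.
  by rewrite /n witt_blocks_through ?cards1.
have n2 x y : x != y -> n (fun c => (x \in c) && (y \in c)) = 21.
  move=> neq_xy; rewrite (eqn _ (fun c => [set x; y] \subset c)) => [|c].
    by rewrite /n witt_blocks_through ?cards2 // neq_xy.
  by rewrite subUset !sub1set.
have n_qab : n (fun c => [&& q \in c, a \in c & b \in c]) = 5.
  have c3 : #|q |: [set a; b]| = 3.
    by rewrite cardsU1 cards2 !inE negb_or neq_ab ![q == _]eq_sym neq_aq neq_bq.
  rewrite (eqn _ (fun c => (q |: [set a; b]) \subset c)) => [|c].
    by rewrite /n witt_blocks_through ?c3.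
  by rewrite !subUset !sub1set.
rewrite card_vertex_set /= (_ : [set _ | false && false] = set0) ?cards0; last first.
  by apply/setP=> c; rewrite inE.
rewrite (card_sig_set (fun u : {set T} => (u \in W) && (q \in u))
  (fun u => (a \notin u) && (b \notin u))).
rewrite (card_sig_set (fun v : {set T} => (v \in W) && (q \notin v))
  (fun v => (a \in v) && (b \in v))).
have -> : #|[set u | (u \in W) && (q \in u) & (a \notin u) && (b \notin u)]|
    = n (fun u => (q \in u) && (a \notin u) && (b \notin u)).
  by apply: eq_card => c; rewrite !inE !andbA.
have -> : #|[set v | (v \in W) && (q \notin v) & (a \in v) && (b \in v)]|
    = n (fun v => (a \in v) && (b \in v) && (q \notin v)).
  by apply: eq_card => c; rewrite !inE -!andbA; do !bool_congr; rewrite andbC -andbA.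
have qb_a : n (fun c => (q \in c) && (b \in c) && (a \in c)) = 5.
  by rewrite -n_qab; apply: eqn => c; rewrite -andbA (andbC (b \in c)).
have ab_q : n (fun c => (a \in c) && (b \in c) && (q \in c)) = 5.
  by rewrite -n_qab; apply: eqn => c; rewrite andbC.
have qb_na : n (fun c => (q \in c) && (b \in c) && (a \notin c))
    = n (fun c => (q \in c) && (a \notin c) && (b \in c)).
  by apply: eqn => c; rewrite andbAC.
(* The first splitting counts the blocks through a and b that avoid q. Among the
   77 - 21 blocks through q that avoid a, those that contain b have to be
   removed; the last splitting counts them. *)
have /= := split q (fun c => (a \in c) && (b \in c)).
have /= := split a (fun c => q \in c).
have /= := split b (fun c => (q \in c) && (a \notin c)).
have /= := split a (fun c => (q \in c) && (b \in c)).
have neq_qa : q != a by rewrite eq_sym.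
have neq_qb : q != b by rewrite eq_sym.
by rewrite n_q !n2 // qb_a ab_q qb_na; lia.
Qed.

Theorem theorem7 (T : finType) (W : {set {set T}}) (q : T)
    (hW : steiner_system 4 7 23 W) :
  ~ exists S : {set {perm (mcl_vertex W q)}},
      S \subset McL2 W q /\ sharply_transitive S.
Proof.
case=> S [sSG trS]; have [cT _ _] := hW.
have [a [b neq_ab]] : exists a b : mclB q, a != b.
  have : 1 < #|{: mclB q}| by rewrite card_sig cardC1 cT.
  by case/card_gt1P=> a [b [_ _ ?]]; exists a, b.
pose x : mcl_vertex W q := inl a; pose y : mcl_vertex W q := inl b.
have : 3 %| #|mcl_points W q| * #|[set z | mcl_adj x z && mcl_adj y z]|.
  apply: dvdn_card_sharply_transitive trS _ => s Ss.
  have As : s \in McL2 W q := subsetP sSG s Ss.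
  have -> : [set z in mcl_points W q | s z \in [set z | mcl_adj x z && mcl_adj y z]]
     = [set z in mcl_points W q | mcl_adj (s^-1 x)%g z && mcl_adj (s^-1 y)%g z].
    apply/setP=> z; rewrite !inE; congr (_ && _).
    by rewrite -{1}(permKV s x) -{1}(permKV s y) !(graph_autE _ _ As).
  apply: dvdn3_common_nbrs_in_points => //.
    by rewrite (inj_eq perm_inj); apply: contra neq_ab => /eqP[->].
  by rewrite -(graph_autE _ _ As) !permKV.
by rewrite (card_mcl_points W q cT) card_common_nbrs_points.
Qed.
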